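(* Let $(X,d,m)$ be a metric measure space and $f\in \mathrm{BV}(X)$. Then the total variation measure $|Df|$ is absolutely continuous with respect to the $2$-capacity: $|Df|\ll \mathrm{Cap}$, i.e. $|Df|(B)=0$ for every Borel set $B\subseteq X$ with $\mathrm{Cap}(B)=0$.
   Context: A metric measure space $(X,d,m)$: $(X,d)$ is a complete separable metric space which is not a single point, $m$ is a non-negative Borel measure finite on balls, with $m(B_r(x))>0$ for all $x\in X$, $r>0$. $\mathrm{lip}(f)(x)=\limsup_{y\to x}\frac{|f(y)-f(x)|}{d(y,x)}$ ($0$ if $x$ is isolated). $\mathrm{LIP}_{loc}(A)$: functions Lipschitz in a neighbourhood of each point of the open set $A$. Total variation: for $f\in L^1_{loc}(m)$ and $A\subseteq X$ open, $$|Df|(A)=\inf\Big\{\liminf_k\int_A \mathrm{lip}(f_k)\,dm:\ f_k\in\mathrm{LIP}_{loc}(A),\ f_k\to f\text{ in }L^1_{loc}(A,m)\Big\},$$ where $L^1_{loc}(A,m)$-convergence means $L^1$-convergence in a neighbourhood of each point of $A$. $f\in\mathrm{BV}(X)$ if $f\in L^1(m)$ and $|Df|(X)<\infty$; then $|Df|(\cdot)$ is the restriction to open sets of a finite Borel measure, denoted with the same symbol. Sobolev space: $\mathrm{Ch}(f)=\frac12\inf\{\liminf_k\int_X\mathrm{lip}(f_k)^2dm: f_k \text{ bounded Lipschitz in } L^2(m),\ f_k\to f\text{ in }L^2(m)\}$ for $f\in L^2(m)$; $H^{1,2}(X)=\{\mathrm{Ch}<\infty\}$ with $\|f\|_{H^{1,2}}^2=\|f\|_{L^2}^2+2\mathrm{Ch}(f)$.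 Capacity: for any $A\subseteq X$, $\mathrm{Cap}(A)=\inf\{\|f\|^2_{H^{1,2}(X)}: f\in H^{1,2}(X),\ f\ge1\ m\text{-a.e. on some neighbourhood of }A\}$. *)

(* Defs.v *)
From HB Require Import structures.
From mathcomp Require Import all_boot all_order all_algebra.
From mathcomp Require Import all_classical all_reals all_analysis.

Set Implicit Arguments.
Unset Strict Implicit.
Unset Printing Implicit Defensive.

Import Order.TTheory GRing.Theory Num.Theory.
Import numFieldNormedType.Exports.

Local Open Scope classical_set_scope.
Local Open Scope ring_scope.

#[short(type="completeMetricType")]
HB.structure Definition CompleteMetric (R : numDomainType) :=
  {T of Complete T & Metric R T}.

Notation borel X := (g_sigma_algebraType (@open X)).

Section lipschitz.
Context (R : realType) (X : completeMetricType R).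
Implicit Types (f : X -> R) (A U : set X) (x y : X).

(* MathComp-Analysis defines Lipschitz functions on normed modules only. *)
Definition lipschitz_in A f :=
  exists L : R, forall x y, A x -> A y -> `|f x - f y| <= L * mdist x y.

Definition LIP_loc A f :=
  forall x, A x -> exists2 U, nbhs x U & lipschitz_in U f.

(* At an isolated point the filter x^' is improper and the limsup would be
   -oo. *)
Definition lip f x : \bar R :=
  if `[< isolated [set: X] x >] then 0%E
  else limf_esup (fun y => (`|f y - f x| / mdist y x)%:E) x^'.

End lipschitz.

Section metric_measure.
Context (R : realType) (X : completeMetricType R).
Variable m : {measure set (borel X) -> \bar R}.
Implicit Types (f g : X -> R) (u : nat -> X -> R) (A : set X).
Local Open Scope ereal_scope.

Record metric_measure_space : Prop := {
  mms_separable : exists2 D : set X, countable D & dense D ;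
  mms_not_single_point : exists x y : X, x <> y ;
  mms_ball_fin : forall (x : X) (r : R), m (ball x r) < +oo ;
  mms_ball_gt0 : forall (x : X) (r : R), (0 < r)%R -> 0 < m (ball x r) }.

Definition cvg_L1_loc A u f :=
  forall x, A x -> exists U : set X, [/\ open U, U x, U `<=` A &
    (fun k => \int[m]_(y in U) `|u k y - f y|%:E) @ \oo --> 0].

(* |Df|(A) for open A. *)
Definition totvar f A : \bar R :=
  ereal_inf [set limn_einf (fun k => \int[m]_(x in A) lip (u k) x)
    | u in [set u | (forall k, LIP_loc A (u k)) /\ cvg_L1_loc A u f]].

Definition BV f :=
  m.-integrable [set: borel X] (EFin \o f) /\ totvar f [set: X] < +oo.

(* mu is the total variation measure |Df|: a finite Borel measure is determined
   by its values on open sets, so there is at most one such mu, and for f in BV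
   there is exactly one. *)
Definition is_total_variation_measure f
    (mu : {finite_measure set (borel X) -> \bar R}) :=
  forall A, open A -> mu A = totvar f A.

Definition L2 f := (f : borel X -> R) \in Lfun m 2%:E.

Definition cvg_L2 u f :=
  (fun k => 'N[m]_2%:E[EFin \o (u k \- f)%R]) @ \oo --> 0.

Definition Ch f : \bar R := (2^-1)%:E *
  ereal_inf [set limn_einf (fun k => \int[m]_x (lip (u k) x ^+ 2))
    | u in [set u | (forall k, [/\ bounded_fun (u k),
                        lipschitz_in [set: X] (u k) & L2 (u k)]) /\
                    cvg_L2 u f]].

Definition H12 f := L2 f /\ Ch f < +oo.

Definition H12_norm2 f : \bar R := 'N[m]_2%:E[EFin \o f] ^+ 2 + 2%:E * Ch f.

Definition Cap A : \bar R :=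
  ereal_inf [set H12_norm2 f | f in [set f | H12 f /\
    exists2 U : set X, set_nbhs A U & {ae m, forall x, U x -> (1 <= f x)%R}]].

End metric_measure.

(* Main.v *)
(* It suffices to show |Df|(B & A) = 0 for an open ball A. Choose open
   neighbourhoods V_n of B carrying test functions g_n of H^{1,2}-norm tending
   to 0. Up to |Df|-measure e, the set B & A is contained in
   K = A & \bigcap_n C_n, where C_n is the set of points at distance at least
   some d_n > 0 from the complement of V_n. Approximating g_n by Lipschitz
   functions and taking a maximum with a bump of slope O(1/d_n) yields Lipschitz
   functions 0 <= phi <= 1, equal to 1 near K, with phi and lip(phi) arbitrarily
   small in L^1(A).
   Now let u_k be an optimal sequence for |Df|(A \ K). The truncations of u_k
   between -N (1 - phi) and N (1 - phi) are locally Lipschitz on the whole of A,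
   with slope at most lip(u_k) + N lip(phi). Letting phi -> 0 fast and then
   N -> oo, a diagonal sequence converges to f and gives
   |Df|(A) <= |Df|(A \ K), that is, |Df|(K) = 0.
   Truncation at a variable level replaces the Leibniz rule and makes it
   unnecessary to assume f bounded. *)
Require Import Defs.
From mathcomp Require Import all_boot all_order all_algebra.
From mathcomp Require Import all_classical all_reals all_analysis.
From mathcomp Require Import measurable_realfun.
From mathcomp Require Import ring lra.

Set Implicit Arguments.
Unset Strict Implicit.
Unset Printing Implicit Defensive.

Import Order.TTheory GRing.Theory Num.Theory.
Import numFieldNormedType.Exports.

Local Open Scope classical_set_scope.
Local Open Scope ring_scope.

(** * The slope *)

Section lip_theory.
Context (R : realType) (X : completeMetricType R).
Implicit Types (f g h : X -> R) (A K U V : set X) (x y z : X).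

Lemma near_mdist x (P : X -> Prop) :
  (\forall y \near x, P y) <-> exists2 e : R, 0 < e & forall y, mdist x y < e -> P y.
Proof. by split=> [/metricType_numDomainType.nbhs_mdistP[e e0 eP]|[e e0 eP]];
  [|apply/metricType_numDomainType.nbhs_mdistP]; exists e. Qed.

Lemma isolated_setT x :
  isolated [set: X] x <-> \forall y \near x, y = x.
Proof.
split=> [[_ [V Vx]]|near_x].
  rewrite setIT => Vx1; apply: filterS Vx => y; by rewrite Vx1.
split; first by rewrite inE.
exists [set x]; last by rewrite setIT.
exact: near_x.
Qed.

(** Clearing the denominator readmits [y = x], and at an isolated point both sides hold because
    [0 <= s]. Upper bounds on slopes are all obtained through this form. *)
Lemma lip_leP f x (s : R) : 0 <= s ->
  (lip f x <= s%:E)%E <->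
  forall e : R, 0 < e -> \forall y \near x, `|f y - f x| <= (s + e) * mdist y x.
Proof.
move=> s0; rewrite /lip; case: ifPn => [/asboolP/isolated_setT ix|_].
  split=> [_ e e0|_]; last by rewrite lee_fin.
  by apply: filterS ix => y ->; rewrite subrr normr0 mdistxx mulr0.
split=> [lims e e0|lims].
  have /ereal_inf_lt[_ [V Vx <-] supV] : (limf_esup
      (fun y => (`|f y - f x| / mdist y x)%:E) x^' < (s + e)%:E)%E.
    by rewrite (le_lt_trans lims)// lte_fin ltrDl.
  near=> y; have [->|yx] := eqVneq y x.
    by rewrite subrr normr0 mdistxx mulr0.
  rewrite -ler_pdivrMr ?mdist_gt0// -lee_fin ltW// (le_lt_trans _ supV)//.
  apply: ereal_sup_ubound; exists y => //.
  by move: yx; near: y.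
apply/lee_addgt0Pr => e e0; rewrite -EFinD.
pose V := [set y | y != x /\ `|f y - f x| <= (s + e) * mdist y x].
apply: (@le_trans _ _ (ereal_sup
    ((fun y => (`|f y - f x| / mdist y x)%:E) @` V))); last first.
  apply: ge_ereal_sup => _ [y [yx fy] <-].
  by rewrite lee_fin ler_pdivrMr ?mdist_gt0.
apply: ereal_inf_lbound; exists V => //.
by apply: filterS (lims e e0) => y fy yx; split.
Unshelve. all: by end_near. Qed.

Lemma lip_ge0 f x : (0 <= lip f x)%E.
Proof.
rewrite /lip; case: ifPn => // /asboolPn/isolated_setT nix.
apply: le_ereal_inf_tmp => _ [V Vx <-].
have [y Vy] : exists y, V y.
  apply: contra_notP nix => V0.
  have nearV : \forall y \near x, y != x -> V y by exact: Vx.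
  apply: filterS nearV => y yV.
  by apply: contra_notP V0 => /eqP yx; exists y; exact: yV.
apply: (@le_trans _ _ (`|f y - f x| / mdist y x)%:E).
  by rewrite lee_fin divr_ge0// mdist_ge0.
by apply: ereal_sup_ubound; exists y.
Qed.

Lemma LIP_loc_near A f x : LIP_loc A f -> A x ->
  exists2 L : R, 0 <= L & \forall y \near x, \forall z \near x,
    `|f y - f z| <= L * mdist y z.
Proof.
move=> Af /Af[U Ux [L fL]]; exists `|L| => //.
near=> y; near=> z; apply: (le_trans (fL _ _ _ _)); [by near: y|by near: z|].
by rewrite ler_wpM2r ?mdist_ge0 ?ler_norm.
Unshelve. all: by end_near. Qed.

Lemma LIP_loc_lip_fin_num A f x : LIP_loc A f -> A x -> lip f x \is a fin_num.
Proof.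
move=> Af /(LIP_loc_near Af)[L L0 fL]; rewrite ge0_fin_numE ?lip_ge0//.
apply: (@le_lt_trans _ _ L%:E); last exact: ltry.
apply/lip_leP => // e e0; apply: filterS fL => y /nbhs_singleton/le_trans; apply.
by rewrite ler_wpM2r ?mdist_ge0// lerDl ltW.
Qed.

Lemma LIP_loc_continuous A f x : LIP_loc A f -> A x -> {for x, continuous f}.
Proof.
move=> Af /(LIP_loc_near Af)[L L0 fL]; apply/cvgrPdist_lt => e e0.
have {}fL : \forall y \near x, `|f y - f x| <= L * mdist y x.
  by apply: filterS fL => y /nbhs_singleton.
have [L0'|Lneq0] := eqVneq L 0.
  by apply: filterS fL => y; rewrite distrC L0' mul0r => /le_lt_trans; exact.
have Lgt0 : 0 < L by rewrite lt_neqAle eq_sym Lneq0.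
near=> y; rewrite distrC; apply: (@le_lt_trans _ _ (L * mdist y x)).
  by near: y.
rewrite mulrC -ltr_pdivlMr//; near: y; apply/near_mdist.
exists (e / L); first by rewrite divr_gt0.
by move=> z; rewrite metric_sym.
Unshelve. all: by end_near. Qed.

(** Common source of the slope bounds for truncations and for maxima with a bump: a limit superior
    is monotone and subadditive. The term in [c] serves for the bump, which enters only through its
    Lipschitz constant. *)
Lemma lip_le f g h x (a b c : R) : 0 <= a -> 0 <= b -> 0 <= c ->
  lip g x \is a fin_num -> lip h x \is a fin_num ->
  (\forall y \near x, `|f y - f x| <=
     a * `|g y - g x| + b * `|h y - h x| + c * mdist y x) ->
  (lip f x <= a%:E * lip g x + b%:E * lip h x + c%:E)%E.
Proof.
move=> a0 b0 c0 /fineK gfin /fineK hfin fgh.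
have g0 : 0 <= fine (lip g x) by rewrite fine_ge0// lip_ge0.
have h0 : 0 <= fine (lip h x) by rewrite fine_ge0// lip_ge0.
move: gfin hfin g0 h0; set p := fine _; set q := fine _ => gp hq p0 q0.
rewrite -gp -hq -!EFinM -!EFinD; apply/lip_leP => [|e e0].
  by rewrite !addr_ge0// mulr_ge0.
(* The errors add up to [(a + b) * d], at most [e]; the summand 1 keeps the denominator positive
   when [a = b = 0]. *)
pose d := e / (a + b + 1).
have ab0 : 0 < a + b + 1 by rewrite ltr_wpDl// addr_ge0.
have d0 : 0 < d by rewrite divr_gt0.
have ed : (a + b) * d <= e.
  by rewrite /d mulrA ler_pdivrMr// mulrC ler_wpM2l ?(ltW e0)// lerDl.
have /lip_leP-/(_ p0 d d0) glip : (lip g x <= p%:E)%E by rewrite gp.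
have /lip_leP-/(_ q0 d d0) hlip : (lip h x <= q%:E)%E by rewrite hq.
near=> y.
have fy : `|f y - f x| <= a * `|g y - g x| + b * `|h y - h x| + c * mdist y x.
  by near: y.
have gy : `|g y - g x| <= (p + d) * mdist y x by near: y.
have hy : `|h y - h x| <= (q + d) * mdist y x by near: y.
apply: (le_trans fy).
apply: (@le_trans _ _ (a * ((p + d) * mdist y x) + b * ((q + d) * mdist y x) +
   c * mdist y x)).
  by rewrite lerD2r lerD// ler_wpM2l.
have : (a + b) * d * mdist y x <= e * mdist y x by rewrite ler_wpM2r// mdist_ge0.
lra.
Unshelve. all: by end_near. Qed.

Lemma open_measurable_borel A : open A -> measurable (A : set (borel X)).
Proof. exact: sub_sigma_algebra. Qed.

Lemma LIP_loc_measurable A f : open A -> LIP_loc A f ->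
  measurable_fun (A : set (borel X)) (f : borel X -> R).
Proof.
move=> oA Af; apply: (measurability _ (RGenOInfty.measurableE R)).
move=> _ [_ [t ->] <-]; apply: open_measurable_borel.
rewrite openE => x [Ax] /=; rewrite in_itv/= andbT => tfx.
near=> y; split; first by near: y; exact: open_nbhs_nbhs.
rewrite /= in_itv/= andbT; near: y.
exact: (cvgr_gt _ (LIP_loc_continuous Af Ax)).
Unshelve. all: by end_near. Qed.

Lemma LIP_loc_lip_measurable A f : open A -> LIP_loc A f ->
  measurable_fun (A : set (borel X)) (lip f : borel X -> \bar R).
Proof.
move=> oA Af; apply: (measurability _ (ErealGenOInfty.measurableE R)).
move=> _ [_ [t ->] <-].
have [t0|t0] := ltP t 0.
  rewrite (_ : _ `&` _ = A); first exact: open_measurable_borel.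
  apply/setIidPl => x _ /=; rewrite in_itv/= andbT.
  by rewrite (lt_le_trans _ (lip_ge0 f x))// lte_fin.
(* The slope exceeds [t] iff, for some [k], the difference quotient exceeds [t + 1/(k+1)] at points
   arbitrarily close to [x]. Each [O k n] is open: by continuity of [f], the witness [y] for [x]
   still serves for nearby base points. *)
pose O (k n : nat) := [set x | A x /\ exists2 y, mdist y x < n.+1%:R^-1 &
  `|f y - f x| > (t + k.+1%:R^-1) * mdist y x].
rewrite (_ : _ `&` _ = \bigcup_k \bigcap_n O k n).
  apply: bigcupT_measurable => k; apply: bigcapT_measurable => n.
  apply: open_measurable_borel; rewrite openE => x [Ax [y yx fyx]].
  set s := t + _ in fyx; have s0 : 0 < s by rewrite ltr_wpDl.
  (* Moving the base point to [z] costs less than [e / 2] in the value of [f] and less than [e / 2]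
     in the distance term, so the strict inequality survives. *)
  pose e : R := `|f y - f x| - s * mdist y x.
  have eE : e = `|f y - f x| - s * mdist y x by [].
  have e0 : 0 < e by rewrite subr_gt0.
  near=> z; split; first by near: z; exact: open_nbhs_nbhs.
  exists y.
    rewrite (le_lt_trans (metric_triangle _ x _))//.
    rewrite -ltrBrDl; near: z; apply/near_mdist.
    by exists (n.+1%:R^-1 - mdist y x); rewrite ?subr_gt0.
  have zx : mdist x z < e / (2 * s).
    near: z; apply/near_mdist; exists (e / (2 * s)) => //.
    by rewrite divr_gt0// mulr_gt0.
  have fzx : `|f x - f z| < e / 2.
    near: z; apply: (@cvgr_dist_lt _ _ _ _ _ f (f x)) => //.
    - exact: LIP_loc_continuous Af Ax.
    - by rewrite divr_gt0.
  have yz := metric_triangle y x z.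
  have syz : s * mdist y z <= s * mdist y x + s * mdist x z.
    by rewrite -mulrDr ler_pM2l.
  have szx : s * mdist x z < e / 2.
    by move: zx; rewrite invfM mulrA ltr_pdivlMr// mulrC.
  have fyzx : `|f y - f x| <= `|f y - f z| + `|f x - f z|.
    by rewrite (distrC (f x)) (le_trans _ (ler_normD _ _))// subrKA.
  rewrite -/s; lra.
apply/seteqP; split=> [x [Ax] /=|x OK].
  rewrite in_itv/= andbT ltNge => /negP tx.
  have [k tk] : exists k : nat,
      ~ \forall y \near x, `|f y - f x| <= (t + k.+1%:R^-1) * mdist y x.
    apply: contra_notP tx => /forallNP tx; apply/lip_leP => // e e0.
    have [k _ ke] := near_infty_natSinv_lt (PosNum e0).
    have /contrapT := tx k; apply: filterS => y /le_trans; apply.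
    rewrite ler_wpM2r ?mdist_ge0// lerD2l ltW//; exact: ke (leqnn k).
  exists k => // n _; split => //.
  apply: contra_notP tk => nO; apply/near_mdist; exists n.+1%:R^-1 => // y yx.
  rewrite leNgt; apply/negP => fy; apply: nO; exists y => //.
  by rewrite metric_sym.
have [k _ kO] := OK; have [Ax _] := kO 0 I; split => //=.
rewrite in_itv/= andbT ltNge; apply/negP => /lip_leP.
have k0 : 0 < k.+1%:R^-1 :> R by [].
move=> /(_ t0 _ k0)/near_mdist[e e0 ex].
have [n _ /(_ n (leqnn _)) ne] := near_infty_natSinv_lt (PosNum e0).
have [_ [y yx]] := kO n I; rewrite ltNge => /negP; apply; apply: ex => /=.
by rewrite metric_sym (lt_trans yx).
Unshelve. all: by end_near. Qed.

End lip_theory.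

(** * Limits of integrals *)

Section ereal_limits.
Context (R : realType).
Implicit Types (v : (\bar R)^nat) (t : \bar R).
Local Open Scope ereal_scope.

(** Otherwise the infimum of some tail would be at least [t]. This selects indices that are both
    late and nearly optimal. *)
Lemma limn_einf_lt_frequently v t : limn_einf v < t ->
  forall N, exists2 k, (N <= k)%N & v k < t.
Proof.
move=> vt N; apply: contrapT => vN; move: vt; apply/negP.
rewrite -leNgt limn_einf_lim (cvg_lim _ (@cvg_einfs_sup _ v))//.
apply: (@le_trans _ _ (einfs v N)); last by apply: ereal_sup_ubound; exists N.
apply: le_ereal_inf_tmp => _ [k /= Nk <-]; rewrite leNgt; apply/negP => vk.
by apply: vN; exists k.
Qed.

Lemma limn_einf_le_frequently v t :
  (forall N, exists2 k, (N <= k)%N & v k <= t) -> limn_einf v <= t.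
Proof.
move=> vt; rewrite limn_einf_lim (cvg_lim _ (@cvg_einfs_sup _ v))//.
apply: ge_ereal_sup => _ [N _ <-]; have [k Nk vk] := vt N.
by apply: le_trans vk; apply: ereal_inf_lbound; exists k.
Qed.

(** Convergence in the extended reals to a finite limit also requires eventually finite values; the
    case [e = 1] provides them. *)
Lemma ge0_cvge0P v : (forall k, 0 <= v k) ->
  v @ \oo --> 0 <-> forall e : R, (0 < e)%R -> \forall k \near \oo, v k <= e%:E.
Proof.
move=> v0; split=> [v0' e e0|ve].
  near=> k; apply/ltW; near: k.
  have : nbhs (0 : \bar R) [set x | x < e%:E].
    by apply: open_nbhs_nbhs; split; [exact: open_ereal_lt_ereal|rewrite /= lte_fin].
  exact: v0'.
apply/fine_cvgP; split.
  apply: filterS (ve 1%R ltr01) => k vk; rewrite ge0_fin_numE//.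
  by rewrite (le_lt_trans vk) ?ltry.
apply/cvgrPdist_le => e e0; apply: filterS (ve e e0) => k vk /=.
rewrite sub0r normrN ger0_norm ?fine_ge0// -lee_fin fineK//.
by rewrite ge0_fin_numE// (le_lt_trans vk) ?ltry.
Unshelve. all: by end_near. Qed.

End ereal_limits.

(** * Convergence of integrals from the pieces of a countable cover *)

Section integral_cover.
Context d (T : measurableType d) (R : realType).
Variable m : {measure set T -> \bar R}.
Implicit Types (A E : set T).
Local Open Scope ereal_scope.

Lemma ge0_integral_setU_le A E (v : T -> \bar R) : measurable A -> measurable E ->
  measurable_fun (A `|` E) v -> (forall x, (A `|` E) x -> 0 <= v x) ->
  \int[m]_(x in A `|` E) v x <= \int[m]_(x in A) v x + \int[m]_(x in E) v x.
Proof.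
move=> mA mE mv v0; have mEA : measurable (E `\` A) by exact: measurableD.
have AE : A `|` E = A `|` (E `\` A) by rewrite setDE setUIr setUv setIT.
rewrite AE ge0_integral_setU//; first last.
- by apply/disj_setPS => x [Ax [_]].
- by move=> x; rewrite -AE; exact: v0.
- by rewrite -AE.
rewrite leeD2l// ge0_subset_integral//; last by move=> x Ex; apply: v0; right.
by apply: measurable_funS mv => //; exact: measurableU.
Qed.

(** On a finite union [F n] of pieces the integrals tend to 0 by subadditivity. The rest [A \ F n]
    decreases to the empty set, hence has small measure as [m A] is finite, and there the integrand
    is bounded by [C]. *)
Lemma cvg_integral_cover0 A (E : (set T)^nat) (v : nat -> T -> R) (C : R) :
  measurable A -> m A < +oo -> (forall j, measurable (E j)) ->
  A = \bigcup_j E j ->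
  (forall k, measurable_fun A (v k)) ->
  (forall k x, A x -> (0 <= v k x <= C)%R) ->
  (forall j, \int[m]_(x in E j) (v k x)%:E @[k --> \oo] --> 0) ->
  \int[m]_(x in A) (v k x)%:E @[k --> \oo] --> 0.
Proof.
move=> mA Afin mE AE mv vC vE.
pose F n := \big[setU/set0]_(j < n) E j.
have FA n : F n `<=` A by rewrite AE; exact: bigsetU_bigcup.
have mF n : measurable (F n) by exact: bigsetU_measurable.
have EA j : E j `<=` A by rewrite AE; exact: bigcup_sup.
have mve k : measurable_fun A (EFin \o v k) by exact/measurable_EFinP.
have int_ge0 k D : D `<=` A -> 0 <= \int[m]_(x in D) (v k x)%:E.
  move=> DA; apply: integral_ge0 => x /DA Ax; rewrite lee_fin.
  by have /andP[] := vC k x Ax.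
have vF n : \int[m]_(x in F n) (v k x)%:E @[k --> \oo] --> 0.
  elim: n => [|n IHn].
    rewrite (_ : (fun k => _) = cst 0); first exact: cvg_cst.
    by apply/funext => k; rewrite /F big_ord0 integral_set0.
  apply: (@squeeze_cvge _ _ _ _ (cst 0) _
      (fun k => \int[m]_(x in F n) (v k x)%:E + \int[m]_(x in E n) (v k x)%:E)).
  - apply: nearW => k; rewrite int_ge0//= /F big_ord_recr/= -/(F n).
    have FEA : F n `|` E n `<=` A by rewrite subUset.
    apply: ge0_integral_setU_le => //; first exact: measurable_funS mA FEA (mve k).
    by move=> x /FEA Ax; rewrite lee_fin; have /andP[] := vC k x Ax.
  - exact: cvg_cst.
  - by rewrite -[X in _ --> X]adde0; apply: cvgeD.
have mAF : m \o (fun n => A `\` F n) @ \oo --> 0.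
  rewrite -(measure0 m) (_ : set0 = \bigcap_n (A `\` F n)).
    apply: nonincreasing_cvg_mu.
    - by rewrite (le_lt_trans _ Afin)// le_measure ?inE//; exact: measurableD.
    - by move=> n; exact: measurableD.
    - by apply: bigcapT_measurable => n; exact: measurableD.
    - move=> a b ab; apply/subsetPset; apply: setDS.
      exact: subset_bigsetU.
  apply/esym; rewrite -subset0 => x /= xAF.
  have [Ax _] := xAF 0%N I.
  have : A x by []; rewrite {1}AE => -[j _ Ejx].
  have [_] := xAF j.+1 I; apply; rewrite /F big_ord_recr/=; by right.
apply/ge0_cvge0P => [k|e e0]; first exact: int_ge0.
(* A strictly positive bound for the integrand, by which [e / 2] can be divided. *)
have C1 : (0 < `|C| + 1)%R by rewrite ltr_wpDl.
have {mAF} := mAF; move=> /(ge0_cvge0P (fun n => measure_ge0 m _)) mAF.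
have e1 : (0 < e / 2 / (`|C| + 1))%R by rewrite !divr_gt0.
have [n _ /(_ n (leqnn n))/= nE] := mAF _ e1.
have e2 : (0 < e / 2)%R by rewrite divr_gt0.
have /ge0_cvge0P-/(_ (fun k => int_ge0 k _ (FA n)) _ e2) := vF n.
apply: filterS => k vk.
have AFE : A = F n `|` (A `\` F n) by rewrite setDUK.
rewrite {1}AFE (le_trans (ge0_integral_setU_le _ _ _ _))//; first exact: measurableD.
- by rewrite -AFE; exact: mve.
- by move=> x; rewrite -AFE => Ax; rewrite lee_fin; have /andP[] := vC k x Ax.
rewrite [e in leRHS]splitr EFinD leeD//.
apply: (@le_trans _ _ (\int[m]_(x in A `\` F n) cst (`|C| + 1)%:E x)).
  apply: ge0_le_integral => //; first exact: measurableD.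
  - by move=> x [Ax _]; rewrite lee_fin; have /andP[] := vC k x Ax.
  - by apply: measurable_funS (mve k) => //; exact: subDsetl.
  - move=> x [Ax _]; rewrite lee_fin; have /andP[_ /le_trans] := vC k x Ax; apply.
    by rewrite (le_trans (ler_norm _))// lerDl.
rewrite integral_cst; last exact: measurableD.
apply: (le_trans (lee_wpmul2l _ nE)); first by rewrite lee_fin ltW.
by rewrite -EFinM mulrC divfK// gt_eqF.
Qed.

End integral_cover.

(** * Truncation at a variable level *)

Section clip.
Context {R : realType}.
Implicit Types a b l : R.

Definition clip l a := Num.max (- l) (Num.min a l).

Lemma clip_cases l a : 0 <= l ->
  [\/ a <= - l /\ clip l a = - l, - l <= a <= l /\ clip l a = a
    | l <= a /\ clip l a = l].
Proof.
move=> l0; rewrite /clip /Order.max /Order.min.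
have [al|la] := ltP a l; have [lx|lx] := ltP (- l) _.
- by constructor 2; rewrite (ltW al) ltW.
- by constructor 1.
- by constructor 3.
- by constructor 3; split => //; lra.
Qed.

(** Nine cases, each linear. The unit cost in the level is what controls the slope when the level
    varies from point to point. *)
Lemma clip_dist l l' a a' : 0 <= l -> 0 <= l' ->
  `|clip l a - clip l' a'| <= `|a - a'| + `|l - l'|.
Proof.
move=> l0 l'0; rewrite ler_norml.
have := ler_norm (a - a'); have := ler_norm (a' - a); rewrite (distrC a').
have := ler_norm (l - l'); have := ler_norm (l' - l); rewrite (distrC l').
by case: (clip_cases a l0) => -[? ->]; case: (clip_cases a' l'0) => -[? ->]; lra.
Qed.

Lemma clip0 a : clip 0 a = 0.
Proof. by case: (clip_cases a (lexx 0)) => -[? ->]; lra. Qed.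

Lemma clip_diff l a b : 0 <= l -> `|clip l a - clip l b| <= 2 * l.
Proof.
move=> l0; rewrite ler_norml.
by case: (clip_cases a l0) => -[? ->]; case: (clip_cases b l0) => -[? ->]; lra.
Qed.

Lemma clip_tail l a : 0 <= l -> `|clip l a - a| <= Num.max (`|a| - l) 0.
Proof.
move=> l0; rewrite le_max ler_norml -(normrN a); apply/orP.
have := ler_norm a; have := ler_norm (- a); rewrite normrN => h1 h2.
by case: (clip_cases a l0) => -[? ->]; [left|right|left]; rewrite ?subrr ?normr0//; lra.
Qed.

(** Three errors: lowering the level from [N] to [N * (1 - s)], exchanging [a] for [b] at the common
    level [N], and truncating [b]. The minimum with [2 * N] keeps the second one bounded, so that
    local convergence will suffice to integrate it. *)
Lemma clip_scaled_dist (N s a b : R) : 0 <= N -> 0 <= s <= 1 ->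
  `|clip (N * (1 - s)) a - b| <=
  Num.min `|a - b| (2 * N) + N * s + Num.max (`|b| - N) 0.
Proof.
move=> N0 /andP[s0 s1].
have Ns0 : 0 <= N * (1 - s) by rewrite mulr_ge0// subr_ge0.
have h1 := clip_dist a a Ns0 N0; rewrite subrr normr0 add0r in h1.
have h2 := clip_dist a b N0 N0; rewrite subrr normr0 addr0 in h2.
have h3 := clip_diff a b N0; have h4 := clip_tail b N0.
have h5 : `|N * (1 - s) - N| = N * s.
  by rewrite mulrBr mulr1 addrAC subrr add0r normrN ger0_norm// mulr_ge0.
rewrite h5 in h1.
have := ler_distD (clip N b) (clip (N * (1 - s)) a) b.
have := ler_distD (clip N a) (clip (N * (1 - s)) a) (clip N b).
have : `|clip N a - clip N b| <= Num.min `|a - b| (2 * N) by rewrite le_min h2.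
lra.
Qed.

End clip.

(** * Local L1 convergence on a countable open cover *)

Section L1_loc_cover.
Context (R : realType) (X : completeMetricType R).
Variable m : {measure set (borel X) -> \bar R}.
Implicit Types (A K : set X) (f phi : X -> R) (u : nat -> X -> R).

Lemma open_metric_ball (x : X) (r : R) : open (ball x r).
Proof.
rewrite openE => y; rewrite ballEmdist/= => xy; apply/near_mdist.
exists (r - mdist x y); first by rewrite subr_gt0.
move=> z yz /=; rewrite (le_lt_trans (metric_triangle x y z))//.
by rewrite -ltrBrDl.
Qed.

Local Open Scope ereal_scope.

(** A Lindelof argument: the balls with centre in [D] and radius [1/(n+1)] that lie in [A] and on
    which the integrals tend to 0 are countably many, and they cover [A]. *)
Lemma cvg_L1_loc_cover A u f : (exists2 D : set X, countable D & dense D) -> open A ->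
  (forall k, measurable_fun (A : set (borel X))
     ((fun x => `|u k x - f x|%R) : borel X -> R)) ->
  cvg_L1_loc m A u f ->
  exists E : nat -> set X, [/\ forall j, open (E j), A = \bigcup_j E j &
    forall j, \int[m]_(y in E j) `|u k y - f y|%:E @[k --> \oo] --> 0].
Proof.
move=> [D cD dD] /open_measurable_borel mA mu uf.
pose B (p : X * nat) : set X := ball p.1 p.2.+1%:R^-1.
pose good := [set p : X * nat | [/\ D p.1, B p `<=` A &
  \int[m]_(y in B p) `|u k y - f y|%:E @[k --> \oo] --> 0]].
have /countable_injP[i i_inj] : countable good.
  apply: (@sub_countable _ _ _ (D `*` [set: nat])); last exact: countableX.
  by apply: subset_card_le => p [Dp _ _]; split.
(* By injectivity of [i] on [good], the union for [j] is a single ball, or empty when [j] is not the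
   code of a good pair. *)
exists (fun j => \bigcup_(p in good `&` [set p | i p = j]) B p); split.
- by move=> j; apply: bigcup_open => p _; exact: open_metric_ball.
- apply/seteqP; split=> [x Ax|x [j _ [p [[_ BA _] _] /BA]]//].
  have [U [oU Ux UA uU]] := uf x Ax.
  have [r r0 rU] : exists2 r : R, (0 < r)%R & forall y, (mdist x y < r)%R -> U y.
    by apply/near_mdist; exact: open_nbhs_nbhs.
  have r20 : (0 < r / 2)%R by rewrite divr_gt0.
  (* With radius below [r / 2], a ball whose centre lies within that radius of [x] contains [x] and
     stays inside [U]. *)
  have [n _ /(_ n (leqnn _)) nr] := near_infty_natSinv_lt (PosNum r20).
  have n0 : (0 < n.+1%:R^-1 :> R)%R by [].
  have [a [xa Da]] : ball x (n.+1%:R^-1 : R) `&` D !=set0.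
    apply: dD; last exact: open_metric_ball.
    by exists x; exact: ballxx.
  have aU : B (a, n) `<=` U.
    move=> y; rewrite /B/= => ay; apply: rU.
    move: xa ay; rewrite !ballEmdist/= => xa ay.
    rewrite (le_lt_trans (metric_triangle x a y))// (splitr r).
    by rewrite ltrD// (lt_trans _ nr).
  have gan : good (a, n).
    split => //=; first exact: subset_trans UA.
    apply: (@squeeze_cvge _ _ _ _ (cst 0) _
      (fun k => \int[m]_(y in U) `|u k y - f y|%:E)) => //; last exact: cvg_cst.
    apply: nearW => k; apply/andP; split.
      by apply: integral_ge0 => y _; rewrite lee_fin.
    apply: ge0_subset_integral => //.
    - by apply: open_measurable_borel; exact: open_metric_ball.
    - exact: open_measurable_borel.
    - have mkU := measurable_funS mA UA (mu k).
      by apply/measurable_EFinP; exact: mkU.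
  exists (i (a, n)) => //; exists (a, n) => //.
  by rewrite /B/=; exact: ball_sym.
move=> j; have [[p [gp ip]]|nog] := pselect (exists p, good p /\ i p = j).
  rewrite (_ : \bigcup_(_ in _) _ = B p); first by case: gp.
  apply/seteqP; split=> [x [q [gq /= iq] Bq]|x Bp]; last by exists p.
  by rewrite (i_inj p q) ?inE// iq.
rewrite (_ : \bigcup_(_ in _) _ = set0); last first.
  by rewrite -subset0 => x [q [gq /= iq] Bq]; apply: nog; exists q.
rewrite (_ : (fun k => _) = cst 0); first exact: cvg_cst.
by apply/funext => k; rewrite integral_set0.
Unshelve. all: by end_near. Qed.

End L1_loc_cover.

(** * Truncation damped by a cutoff: slope and L1 distance *)

Section damp.
Context (R : realType) (X : completeMetricType R).
Variable m : {measure set (borel X) -> \bar R}.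
Implicit Types (A K : set X) (f phi : X -> R) (u : X -> R).
(* The truncation level [N * (1 - phi)] vanishes where [phi = 1], so that the
   result extends by 0 across that set whatever [u] is there. *)
Definition damp (N : R) phi u : X -> R := fun x => clip (N * (1 - phi x)) (u x).

Lemma lipschitz_LIP_loc f : lipschitz_in [set: X] f -> LIP_loc [set: X] f.
Proof. by move=> fL x _; exists setT => //; exact: filterT. Qed.

Lemma LIP_locS A B f : A `<=` B -> LIP_loc B f -> LIP_loc A f.
Proof. by move=> AB Bf x /AB /Bf. Qed.

Lemma damp_dist N phi u x y : 0 <= N -> (forall z, 0 <= phi z <= 1) ->
  `|damp N phi u x - damp N phi u y| <= `|u x - u y| + N * `|phi x - phi y|.
Proof.
move=> N0 phi01.
have Nphi0 z : 0 <= N * (1 - phi z).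
  by rewrite mulr_ge0// subr_ge0; have /andP[] := phi01 z.
apply: (le_trans (clip_dist _ _ (Nphi0 x) (Nphi0 y))).
rewrite lerD2l (_ : _ - _ = N * (phi y - phi x)); last by ring.
by rewrite normrM (ger0_norm N0) distrC.
Qed.

Lemma damp_LIP_loc A K N phi u : 0 <= N -> (forall z, 0 <= phi z <= 1) ->
  lipschitz_in [set: X] phi -> (forall x, K x -> \forall y \near x, phi y = 1) ->
  LIP_loc (A `\` K) u -> LIP_loc A (damp N phi u).
Proof.
move=> N0 phi01 [L phiL] phiK ulip x Ax.
have [Kx|nKx] := pselect (K x).
  exists [set y | phi y = 1]; first exact: phiK.
  exists 0 => y z /= y1 z1.
  by rewrite /damp y1 z1 subrr mulr0 !clip0 subrr normr0 mul0r.
have [U Ux [L' uL']] := ulip x (conj Ax nKx).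
exists U => //; exists (L' + N * L) => y z Uy Uz.
rewrite (le_trans (damp_dist _ _ _ N0 phi01))// mulrDl lerD ?uL'//.
by rewrite -mulrA ler_wpM2l// phiL.
Qed.

Local Open Scope ereal_scope.

Lemma damp_lip A N phi u x : (0 <= N)%R -> (forall z, 0 <= phi z <= 1)%R ->
  lipschitz_in [set: X] phi -> LIP_loc A u -> A x ->
  lip (damp N phi u) x <= lip u x + N%:E * lip phi x.
Proof.
move=> N0 phi01 philip ulip Ax.
rewrite -[lip u x]mul1e -[leRHS]adde0; apply: lip_le => //.
- exact: LIP_loc_lip_fin_num ulip Ax.
- exact: LIP_loc_lip_fin_num (lipschitz_LIP_loc philip) I.
- by apply: nearW => y; rewrite mul1r mul0r addr0; exact: damp_dist.
Qed.

(** Since [K] is null, the integral over [A] reduces to [A \ K], where [u] is locally Lipschitz and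
    the pointwise slope bound applies. *)
Lemma integral_damp_lip A K N phi u : (0 <= N)%R ->
  (forall z, 0 <= phi z <= 1)%R -> lipschitz_in [set: X] phi ->
  (forall x, K x -> \forall y \near x, phi y = 1%R) ->
  open A -> open (A `\` K) -> K `<=` A -> m K = 0 -> LIP_loc (A `\` K) u ->
  \int[m]_(x in A) lip (damp N phi u) x <=
  \int[m]_(x in A `\` K) lip u x + N%:E * \int[m]_(x in A) lip phi x.
Proof.
move=> N0 phi01 philip phiK oA oB KA mK0 ulip.
have mA := open_measurable_borel oA; have mB := open_measurable_borel oB.
have mK : measurable (K : set (borel X)).
  (* [K] is the difference of the open sets [A] and [A \ K]. *)
  by rewrite -(setIidr KA) -setDD; exact: measurableD.
have wlip := damp_LIP_loc N0 phi01 philip phiK ulip.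
have phiLA := LIP_locS (@subsetT _ A) (lipschitz_LIP_loc philip).
have phiLB := LIP_locS (@subsetT _ (A `\` K)) (lipschitz_LIP_loc philip).
have mphiA := LIP_loc_lip_measurable oA phiLA.
have mphiB := LIP_loc_lip_measurable oB phiLB.
have mu := LIP_loc_lip_measurable oB ulip.
have mw := LIP_loc_lip_measurable oA wlip.
rewrite (ge0_negligible_integral mK mA mw _ mK0); last by move=> x _; exact: lip_ge0.
apply: (@le_trans _ _ (\int[m]_(x in A `\` K) (lip u x + N%:E * lip phi x))).
  apply: ge0_le_integral => //.
  - by move=> x _; exact: lip_ge0.
  - by apply: measurable_funS mw => //; exact: subDsetl.
  - by apply: emeasurable_funD => //; exact: measurable_funeM.
  - by move=> x Bx; exact: damp_lip ulip Bx.
rewrite ge0_integralD//; first last.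
- exact: measurable_funeM.
- by move=> x _; rewrite mule_ge0 ?lip_ge0.
- by move=> x _; exact: lip_ge0.
rewrite ge0_integralZl//; last by move=> x _; exact: lip_ge0.
rewrite leeD2l// lee_wpmul2l ?lee_fin//.
apply: (ge0_subset_integral m mB mA mphiA); last exact: subDsetl.
by move=> x _; exact: lip_ge0.
Qed.

Lemma integral_damp_dist A K N phi u f : (0 <= N)%R ->
  (forall z, 0 <= phi z <= 1)%R -> lipschitz_in [set: X] phi ->
  (forall x, K x -> \forall y \near x, phi y = 1%R) ->
  open A -> open (A `\` K) -> K `<=` A -> m K = 0 -> LIP_loc (A `\` K) u ->
  measurable_fun (A : set (borel X)) (f : borel X -> R) ->
  \int[m]_(x in A) `|damp N phi u x - f x|%:E <=
  \int[m]_(x in A `\` K) (Num.min `|u x - f x| (2 * N))%:E +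
  N%:E * \int[m]_(x in A) (phi x)%:E +
  \int[m]_(x in A) (Num.max (`|f x| - N) 0)%:E.
Proof.
move=> N0 phi01 philip phiK oA oB KA mK0 ulip mf.
have mA := open_measurable_borel oA; have mB := open_measurable_borel oB.
have BA : A `\` K `<=` A by exact: subDsetl.
have mK : measurable (K : set (borel X)).
  by rewrite -(setIidr KA) -setDD; exact: measurableD.
have wlip := damp_LIP_loc N0 phi01 philip phiK ulip.
have phiLA := LIP_locS (@subsetT _ A) (lipschitz_LIP_loc philip).
have phi0 x : (0 <= phi x)%R by have /andP[] := phi01 x.
have mphi := LIP_loc_measurable oA phiLA.
have mphiB := measurable_funS mA BA mphi.
have mu := LIP_loc_measurable oB ulip.
have mw := LIP_loc_measurable oA wlip.
have mfB := measurable_funS mA BA mf.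
have mwf : measurable_fun (A : set (borel X))
    ((fun x => `|damp N phi u x - f x|%:E) : borel X -> \bar R).
  by apply/measurable_EFinP/measurableT_comp => //; exact: measurable_funB.
have mmin : measurable_fun (A `\` K : set (borel X))
    ((fun x => (Num.min `|u x - f x| (2 * N))%:E) : borel X -> \bar R).
  apply/measurable_EFinP/measurable_minr => //.
  by apply: measurableT_comp => //; exact: measurable_funB.
have mmax : measurable_fun (A : set (borel X))
    ((fun x => (Num.max (`|f x| - N) 0)%:E) : borel X -> \bar R).
  apply/measurable_EFinP/measurable_maxr => //.
  by apply: measurable_funB => //; exact: measurableT_comp.
have mmaxB := measurable_funS mA BA mmax.
have mNphi : measurable_fun (A `\` K : set (borel X))
    ((fun x => N%:E * (phi x)%:E) : borel X -> \bar R).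
  by apply: measurable_funeM; exact/measurable_EFinP.
have min0 x : 0 <= (Num.min `|u x - f x| (2 * N))%:E.
  by rewrite lee_fin le_min normr_ge0 mulr_ge0.
have max0 x : 0 <= (Num.max (`|f x| - N) 0)%:E by rewrite lee_fin le_max lexx orbT.
have Nphi0 x : 0 <= N%:E * (phi x)%:E by rewrite mule_ge0 ?lee_fin.
rewrite (ge0_negligible_integral mK mA mwf _ mK0)//.
apply: (@le_trans _ _ (\int[m]_(x in A `\` K)
    ((Num.min `|u x - f x| (2 * N))%:E + N%:E * (phi x)%:E +
     (Num.max (`|f x| - N) 0)%:E))).
  apply: ge0_le_integral => //.
  - exact: measurable_funS mwf.
  - by apply: emeasurable_funD => //; exact: emeasurable_funD.
  - move=> x _; rewrite -EFinM -!EFinD lee_fin.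
    exact: clip_scaled_dist.
rewrite ge0_integralD//; first last.
- exact: emeasurable_funD.
- by move=> x _; rewrite adde_ge0.
rewrite ge0_integralD//.
have mphiBe : measurable_fun (A `\` K : set (borel X)) (EFin \o (phi : borel X -> R)).
  exact/measurable_EFinP.
have mphie : measurable_fun (A : set (borel X)) (EFin \o (phi : borel X -> R)).
  exact/measurable_EFinP.
have phi0e x : 0 <= (phi x)%:E by rewrite lee_fin.
rewrite (ge0_integralZl m mB mphiBe (fun x _ => phi0e x)) ?lee_fin//.
rewrite leeD//; last exact: (ge0_subset_integral m mB mA mmax (fun x _ => max0 x) BA).
rewrite leeD2l// lee_wpmul2l ?lee_fin//.
exact: (ge0_subset_integral m mB mA mphie (fun x _ => phi0e x) BA).
Qed.

(** Dominated convergence with majorant [|f|]: at each point the integrand vanishes once [n] reaches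
    [|f x|]. *)
Lemma integral_tail_cvg0 A f : measurable (A : set (borel X)) ->
  m.-integrable [set: borel X] (EFin \o f) ->
  \int[m]_(x in A) (Num.max (`|f x| - n.+1%:R) 0)%:E @[n --> \oo] --> 0.
Proof.
move=> mA intf.
have intfA : m.-integrable (A : set (borel X)) (EFin \o (f : borel X -> R)).
  exact: integrableS intf.
have mf : measurable_fun (A : set (borel X)) (f : borel X -> R).
  by apply/measurable_EFinP; exact: measurable_int intfA.
have [|||||_ _] := @dominated_convergence _ _ _ m (A : set (borel X)) mA
    (fun n => (fun x => (Num.max (`|f x| - n.+1%:R) 0)%:E) : borel X -> \bar R)
    (cst 0) (abse \o (EFin \o f)).
- move=> n; apply/measurable_EFinP/measurable_maxr => //.
  by apply: measurable_funB => //; exact: measurableT_comp.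
- exact: measurable_cst.
- apply: aeW => x _; apply: cvg_near_cst.
  near=> n; congr EFin; apply/eqP.
  rewrite eq_le le_max lexx orbT andbT ge_max lexx andbT subr_le0; near: n.
  apply: filterS (nbhs_infty_ger `|f x|%R) => n /= fn.
  by rewrite (le_trans fn)// ler_nat.
- exact: integrable_abse.
- apply: aeW => x n _ /=; rewrite lee_fin ger0_norm ?le_max ?lexx ?orbT//.
  by rewrite ge_max normr_ge0 andbT lerBlDr lerDl.
- by rewrite integral0.
Unshelve. all: by end_near. Qed.

End damp.

(** * Sets admitting small cutoffs carry no variation *)

Section removable.
Context (R : realType) (X : completeMetricType R).
Variable m : {measure set (borel X) -> \bar R}.
Implicit Types (A K : set X) (f phi : X -> R) (u : nat -> X -> R).
Local Open Scope ereal_scope.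

(** Existence for every [tau > 0] is a form of vanishing 1-capacity of [K] inside [A]. The value 1
    is imposed near each point of [K], so that damped truncations vanish on a neighbourhood of
    it. *)
Definition cutoff A K (tau : R) phi := [/\ lipschitz_in [set: X] phi,
  forall z, (0 <= phi z <= 1)%R, forall x, K x -> \forall y \near x, phi y = 1%R,
  \int[m]_(x in A) (phi x)%:E <= tau%:E & \int[m]_(x in A) lip phi x <= tau%:E].

(** Each cutoff equals 1 on [K], so [m K] is at most its integral, which is at most [tau]. *)
Lemma cutoff_negligible A K : open A -> open (A `\` K) -> K `<=` A ->
  (forall tau : R, (0 < tau)%R -> exists phi, cutoff A K tau phi) -> m K = 0.
Proof.
move=> oA oB KA cutK; have mA := open_measurable_borel oA.
have mK : measurable (K : set (borel X)).
  rewrite -(setIidr KA) -setDD.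
  by apply: measurableD => //; exact: open_measurable_borel.
apply/eqP; rewrite eq_le measure_ge0 andbT; apply/lee_addgt0Pr => e e0.
rewrite add0e; have [phi [philip phi01 phiK phie _]] := cutK e e0.
have mphi : measurable_fun (A : set (borel X)) (EFin \o (phi : borel X -> R)).
  have phiA := LIP_locS (@subsetT _ A) (lipschitz_LIP_loc philip).
  by apply/measurable_EFinP; exact: LIP_loc_measurable oA phiA.
apply: le_trans phie.
rewrite -[leLHS]mul1e -(integral_cst m mK).
rewrite (eq_integral (EFin \o (phi : borel X -> R))) => [|x]; last first.
  by rewrite inE => /phiK/nbhs_singleton/= ->.
apply: (ge0_subset_integral m mK mA mphi) => // x _.
by rewrite lee_fin; have /andP[] := phi01 x.
Qed.

(** The cap [C] and the finite measure of [A] turn local convergence into convergence of the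
    integrals over all of [A]. *)
Lemma cvg_L1_loc_trunc A u f (C : R) : (0 <= C)%R ->
  (exists2 D : set X, countable D & dense D) ->
  open A -> m A < +oo -> (forall k, LIP_loc A (u k)) ->
  measurable_fun (A : set (borel X)) (f : borel X -> R) ->
  cvg_L1_loc m A u f ->
  \int[m]_(x in A) (Num.min `|u k x - f x| C)%:E @[k --> \oo] --> 0.
Proof.
move=> C0 sepX oA Afin ulip mf uf; have mA := open_measurable_borel oA.
have mu k := LIP_loc_measurable oA (ulip k).
have muf k : measurable_fun (A : set (borel X))
    ((fun x => `|u k x - f x|%R) : borel X -> R).
  by apply: measurableT_comp => //; exact: measurable_funB.
have mmin k : measurable_fun (A : set (borel X))
    ((fun x => Num.min `|u k x - f x| C)%R : borel X -> R).
  by apply: measurable_minr.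
have [E [oE AE uE]] := cvg_L1_loc_cover sepX oA muf uf.
have mE j := open_measurable_borel (oE j).
have EA j : E j `<=` A by rewrite AE; exact: bigcup_sup.
apply: (cvg_integral_cover0 (C := C) mA Afin mE AE mmin).
  by move=> k x _; rewrite le_min normr_ge0 C0/= ge_min lexx orbT.
move=> j; apply: (@squeeze_cvge _ _ _ _ (cst 0) _
  (fun k => \int[m]_(y in E j) `|u k y - f y|%:E)) => //; last exact: cvg_cst.
have min0 k x : 0 <= (Num.min `|u k x - f x| C)%:E.
  by rewrite lee_fin le_min normr_ge0.
apply: nearW => k; apply/andP; split; first by apply: integral_ge0 => y _.
apply: ge0_le_integral => //.
- by apply/measurable_EFinP; exact: (measurable_funS mA (EA j) (mmin k)).
- by apply/measurable_EFinP; exact: (measurable_funS mA (EA j) (muf k)).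
- by move=> x _; rewrite lee_fin ge_min lexx.
Qed.

(** Competitors for [A \ K] become competitors for [A] after damping; the level [n + 1] grows while
    the extra slope stays below [1/(n+1)]. *)
Lemma totvar_le_setD A K f (t : R) :
  (exists2 D : set X, countable D & dense D) ->
  open A -> m A < +oo -> open (A `\` K) -> K `<=` A ->
  m.-integrable [set: borel X] (EFin \o f) ->
  (forall tau : R, (0 < tau)%R -> exists phi, cutoff A K tau phi) ->
  totvar m f (A `\` K) < t%:E -> totvar m f A <= t%:E.
Proof.
move=> sepX oA Afin oB KA intf cutK.
move=> /ereal_inf_lt[_ [u [ulip uf] <-] ut].
have mA := open_measurable_borel oA; have mB := open_measurable_borel oB.
have BA : A `\` K `<=` A by exact: subDsetl.
have mK0 := cutoff_negligible oA oB KA cutK.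
have mf : measurable_fun (A : set (borel X)) (f : borel X -> R).
  apply/measurable_EFinP; apply: measurable_funS (measurable_int _ intf) => //.
have mfB := measurable_funS mA BA mf.
have Bfin : m (A `\` K) < +oo by rewrite (le_lt_trans _ Afin)// le_measure ?inE.
pose tail n := \int[m]_(x in A) (Num.max (`|f x| - n.+1%:R) 0)%:E.
have step n : exists w, [/\ LIP_loc A w,
    \int[m]_(x in A) `|w x - f x|%:E <= n.+1%:R^-1%:E + tail n &
    \int[m]_(x in A) lip w x <= (t + n.+1%:R^-1)%:E].
  pose N : R := n.+1%:R; pose e : R := (n.+1%:R^-1)%R.
  have N0 : (0 < N)%R by rewrite /N.
  have e0 : (0 < e)%R by rewrite /e.
  have e20 : (0 < e / 2)%R by rewrite divr_gt0.
  (* Both integrals of [phi] get multiplied by [N], hence the division by [N]. *)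
  have [|phi [philip phi01 phiK phie phile]] := cutK (e / 2 / N)%R.
    by rewrite divr_gt0.
  have Ne : (N * (e / 2 / N) = e / 2)%R by rewrite mulrC divfK// gt_eqF.
  have min0 k : 0 <= \int[m]_(x in A `\` K) (Num.min `|u k x - f x| (2 * N))%:E.
    by apply: integral_ge0 => x _; rewrite lee_fin le_min normr_ge0 mulr_ge0// ltW.
  have N20 : (0 <= 2 * N)%R by rewrite mulr_ge0// ltW.
  have := cvg_L1_loc_trunc N20 sepX oB Bfin ulip mfB uf.
  move=> /(ge0_cvge0P min0)/(_ _ e20)[k0 _ uk0].
  (* One index [k] serves two purposes: late enough for the truncated distance to [f], and with
     slope integral below [t]. *)
  have [k /uk0/= uk utk] := limn_einf_lt_frequently ut k0.
  exists (damp N phi (u k)); split.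
  - exact: damp_LIP_loc (ltW N0) phi01 philip phiK (ulip k).
  - apply: (le_trans (integral_damp_dist (ltW N0) phi01 philip phiK oA oB KA mK0
      (ulip k) mf)).
    rewrite leeD2r// -/e (splitr e) EFinD leeD//.
    by rewrite -[in leRHS]Ne EFinM lee_wpmul2l// lee_fin ltW.
  - apply: (le_trans (integral_damp_lip (ltW N0) phi01 philip phiK oA oB KA mK0
      (ulip k))).
    rewrite EFinD leeD//; first exact: ltW.
    apply: (@le_trans _ _ (e / 2)%:E).
      by rewrite -[in leRHS]Ne EFinM lee_wpmul2l// lee_fin ltW.
    by rewrite lee_fin ler_pdivrMr// ler_peMr ?ler1n// ltW.
have [w wP] := choice step.
apply/lee_addgt0Pr => e e0; rewrite -EFinD.
apply: (@le_trans _ _ (limn_einf (fun k => \int[m]_(x in A) lip (w k) x))).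
  apply: ereal_inf_lbound; exists w => //; split; first by move=> k; have [] := wP k.
  (* The convergence is in L1 on all of [A], so [A] itself is the neighbourhood. *)
  move=> x Ax; exists A; split => //.
  apply: (@squeeze_cvge _ _ _ _ (cst 0) _ (fun k => k.+1%:R^-1%:E + tail k)).
  - apply: nearW => k; have [_ -> _] := wP k; rewrite andbT.
    by apply: integral_ge0 => y _; rewrite lee_fin.
  - exact: cvg_cst.
  - rewrite -[X in _ --> X]adde0; apply: cvgeD => //.
      by apply: cvg_EFin; [exact: nearW|exact: cvg_harmonic].
    exact: integral_tail_cvg0.
apply: limn_einf_le_frequently => N.
have [n _ ne] := near_infty_natSinv_lt (PosNum e0).
exists (maxn N n); first exact: leq_maxl.
have [_ _ /le_trans] := wP (maxn N n); apply.
by rewrite lee_fin lerD2l ltW//; apply: ne; exact: leq_maxr.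
Qed.

End removable.

(** * Cutoffs from capacity *)

Section bump.
Context (R : realType) (X : completeMetricType R).
Implicit Types (K V : set X) (x y : X).

Definition clip01 (a : R) : R := Num.max 0 (Num.min a 1).

Lemma clip01_cases a :
  [\/ a <= 0 /\ clip01 a = 0, 0 <= a <= 1 /\ clip01 a = a | 1 <= a /\ clip01 a = 1].
Proof.
rewrite /clip01 /Order.max /Order.min.
have [al|la] := ltP a 1; have [lx|lx] := ltP 0 _.
- by constructor 2; rewrite (ltW al) ltW.
- by constructor 1.
- by constructor 3.
- by constructor 3; split => //; lra.
Qed.

Lemma clip01_dist a b : `|clip01 a - clip01 b| <= `|a - b|.
Proof.
rewrite ler_norml; have := ler_norm (a - b); have := ler_norm (b - a).
rewrite (distrC b) => h1 h2.
by case: (clip01_cases a) => -[? ->]; case: (clip01_cases b) => -[? ->]; lra.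
Qed.

Lemma clip01_ge0_le1 a : 0 <= clip01 a <= 1.
Proof. by case: (clip01_cases a) => -[? ->]; lra. Qed.

(** For empty [K] this is the default value of an infimum, which is why [exists_bump] treats that
    case apart. *)
Definition dist_to K x : R := inf [set mdist x y | y in K].

Lemma dist_to_has_lbound K x : has_lbound [set mdist x y | y in K].
Proof. by exists 0 => _ [y _ <-]; exact: mdist_ge0. Qed.

Lemma dist_to_le K x y : K y -> dist_to K x <= mdist x y.
Proof. by move=> Ky; apply: ge_inf; [exact: dist_to_has_lbound|exists y]. Qed.

Lemma dist_to_lt K x (r : R) : K !=set0 -> dist_to K x < r ->
  exists2 y, K y & mdist x y < r.
Proof.
move=> [z Kz] /inf_lt[|_ [y Ky <-] yr]; last by exists y.
by exists (mdist x z); exists z.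
Qed.

Lemma dist_to_lipschitz K x y : K !=set0 ->
  `|dist_to K x - dist_to K y| <= mdist x y.
Proof.
move=> K0.
have half a b : dist_to K a <= mdist a b + dist_to K b.
  apply/ler_addgt0Pr => e e0.
  have [|z Kz bz] := @dist_to_lt K b (dist_to K b + e) K0; first by rewrite ltrDl.
  rewrite (le_trans (dist_to_le _ Kz))// (le_trans (metric_triangle a b z))//.
  by rewrite -addrA lerD2l ltW.
have := half x y; have := half y x; rewrite (metric_sym y x) ler_norml; lra.
Qed.

(** The function [2 - (4 / d) * dist_to K], clipped to [0, 1], is 1 at distance at most [d / 4] from
    [K] and 0 from distance [d / 2] on. Points outside [V] are at distance at least [d], so these
    values persist nearby. *)
Lemma exists_bump K V (d : R) : 0 < d -> (forall x, K x -> ball x d `<=` V) ->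
  exists eta : X -> R, [/\ exists2 L : R, 0 <= L &
      forall x y, `|eta x - eta y| <= L * mdist x y,
    forall x, 0 <= eta x <= 1,
    forall x, K x -> \forall y \near x, eta y = 1 &
    forall x, ~ V x -> \forall y \near x, eta y = 0].
Proof.
move=> d0 KV; have [->|/set0P K0] := eqVneq K set0.
  exists (cst 0); split => //= [|x|x _].
  - by exists 0 => // x y; rewrite subrr normr0 mul0r.
  - by rewrite lexx ler01.
  - exact: nearW.
have d40 : 0 < 4 / d by rewrite divr_gt0.
exists (fun x => clip01 (2 - 4 / d * dist_to K x)); split.
- exists (4 / d) => [|x y]; first exact: ltW.
  rewrite (le_trans (clip01_dist _ _))//.
  rewrite (_ : _ - _ = 4 / d * (dist_to K y - dist_to K x)); last by ring.
  by rewrite normrM (gtr0_norm d40) distrC ler_wpM2l ?dist_to_lipschitz// ltW.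
- by move=> x; exact: clip01_ge0_le1.
- move=> x Kx; apply/near_mdist; exists (d / 4) => [|y xy]; first by rewrite divr_gt0.
  have : 4 / d * dist_to K y < 1.
    have := dist_to_le y Kx; rewrite metric_sym mulrAC ltr_pdivrMr// mul1r; lra.
  by case: (clip01_cases (2 - 4 / d * dist_to K y)) => -[? ->]; lra.
- move=> x nVx; apply/near_mdist; exists (d / 2) => [|y xy]; first by rewrite divr_gt0.
  have dx : d <= dist_to K x.
    rewrite leNgt; apply/negP => /(dist_to_lt K0)[z Kz xz]; apply: nVx.
    by apply: (KV _ Kz); rewrite ballEmdist/= metric_sym.
  have dy : d / 2 <= dist_to K y.
    have := dist_to_lipschitz x y K0; rewrite ler_norml; lra.
  have : 2 <= 4 / d * dist_to K y.
    rewrite mulrAC ler_pdivlMr//; lra.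
  by case: (clip01_cases (2 - 4 / d * dist_to K y)) => -[? ->]; lra.
Qed.

End bump.

(** * Lipschitz approximation of functions of small Sobolev norm *)

Section L2.
Context (R : realType) (X : completeMetricType R).
Variable m : {measure set (borel X) -> \bar R}.
Implicit Types (g h : X -> R).
Local Open Scope ereal_scope.

Lemma sqr_Lnorm2 h : 'N[m]_2%:E[EFin \o h] ^+ 2 = \int[m]_x (h x ^+ 2)%:E.
Proof.
have -> : 'N[m]_2%:E[EFin \o h] ^+ 2 = 'N[m]_2%:E[EFin \o h] `^ 2.
  have := Lnorm_ge0 m 2%:E (EFin \o h); case: 'N[m]_2%:E[_] => [r||]//.
  - by rewrite lee_fin => r0; rewrite poweR_EFin powR_mulrn.
  - by move=> _; rewrite poweRyr ?pnatr_eq0// expe2.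
rewrite poweR_Lnorm//.
apply: eq_integral => x _ /=.
by rewrite powR_mulrn// real_normK// num_real.
Qed.

Lemma L2_measurable h : L2 m h -> measurable_fun [set: borel X] (h : borel X -> R).
Proof. by move=> /sub_Lfun_mfun; rewrite inE. Qed.

Lemma cvg_L2_integral (u : nat -> X -> R) g (e : R) : (0 < e)%R -> cvg_L2 m u g ->
  \forall k \near \oo, \int[m]_x ((u k x - g x) ^+ 2)%:E <= e%:E.
Proof.
move=> e0 /ge0_cvge0P ug.
(* The square of [min e 1] is at most [e]. *)
have e10 : (0 < Num.min e 1)%R by rewrite lt_min e0 ltr01.
have := ug (fun k => Lnorm_ge0 _ _ _) _ e10.
apply: filterS => k uk; rewrite -(sqr_Lnorm2 (fun x => u k x - g x)%R).
rewrite (@le_trans _ _ ((Num.min e 1)%:E * (Num.min e 1)%:E))//.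
  by apply: lee_pmul => //; exact: Lnorm_ge0.
have [e1|e1] := leP e 1%R; rewrite -EFinM lee_fin; nra.
Qed.

(** Both terms of the norm are non-negative, so each is below [e]; [h] comes from a sequence nearly
    optimal for [Ch]. The L2 error [theta] is independent of [e] and can later be taken much
    smaller. *)
Lemma H12_norm2_lt g (e : R) : L2 m g -> H12_norm2 m g < e%:E ->
  \int[m]_x (g x ^+ 2)%:E < e%:E /\
  forall theta : R, (0 < theta)%R -> exists h, [/\ lipschitz_in [set: X] h,
    L2 m h, \int[m]_x ((h x - g x) ^+ 2)%:E <= theta%:E &
    \int[m]_x (lip h x ^+ 2) < e%:E].
Proof.
move=> gL2; rewrite /H12_norm2 /Ch; set I := ereal_inf _.
(* The factor 2 of the norm cancels the 1/2 of [Ch]. *)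
rewrite muleA -EFinM divff// mul1e sqr_Lnorm2 => ge.
have I0 : 0 <= I.
  apply: le_ereal_inf_tmp => _ [u _ <-]; rewrite leNgt; apply/negP.
  move=> /limn_einf_lt_frequently/(_ 0%N)[k _]; apply/negP; rewrite -leNgt.
  by apply: integral_ge0 => x _; rewrite expe_ge0 ?lip_ge0.
have g0 : 0 <= \int[m]_x (g x ^+ 2)%:E.
  by apply: integral_ge0 => x _; rewrite lee_fin sqr_ge0.
split; first by rewrite (le_lt_trans _ ge)// leeDl.
move=> theta theta0.
have /ereal_inf_lt[_ [u [uL2 ug] <-]] : I < e%:E.
  by rewrite (le_lt_trans _ ge)// leeDr.
have [k0 _ uk0] := cvg_L2_integral theta0 ug.
move=> /limn_einf_lt_frequently/(_ k0)[k k0k uke].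
by exists (u k); have [_ ? ?] := uL2 k; split => //; exact: uk0.
Qed.

End L2.

(** * Cutoffs built from a bump and a test function for the capacity *)

Section capacity_cutoff.
Context (R : realType) (X : completeMetricType R).
Variable m : {measure set (borel X) -> \bar R}.
Implicit Types (A K V : set X) (g h phi : X -> R).

(* [g] is only L^2-close to a function that is at least 1 on a neighbourhood;
   the maximum with [eta] restores the value 1, and costs the slope of [eta]
   only on the set [E] where [g <= 1/2], whose measure is small. *)
Definition bump_max (eta g : X -> R) : X -> R :=
  fun x => Num.max (eta x) (clip01 (2 * g x)).

Lemma max_dist (a b c d : R) :
  `|Num.max a b - Num.max c d| <= `|a - c| + `|b - d|.
Proof.
rewrite ler_norml; have := ler_norm (a - c); have := ler_norm (c - a).
have := ler_norm (b - d); have := ler_norm (d - b).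
rewrite (distrC d) (distrC c) => h1 h2 h3 h4.
by have [?|?] := leP a b; have [?|?] := leP c d; lra.
Qed.

Lemma clip01_double_dist (a b : R) :
  `|clip01 (2 * a) - clip01 (2 * b)| <= 2 * `|a - b|.
Proof. by rewrite (le_trans (clip01_dist _ _))// -mulrBr normrM ger0_norm. Qed.

Section bump_max.
Variables (eta g : X -> R) (V : set X) (L : R).
Hypotheses (L0 : 0 <= L) (etaL : forall x y, `|eta x - eta y| <= L * mdist x y).
Hypothesis eta01 : forall x, 0 <= eta x <= 1.
Hypothesis etaV : forall x, ~ V x -> \forall y \near x, eta y = 0.
Hypothesis g_lip : lipschitz_in [set: X] g.

Let E := V `&` [set x | g x <= 2^-1].

Lemma bump_max_ge0_le1 x : 0 <= bump_max eta g x <= 1.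
Proof.
have /andP[e0 e1] := eta01 x; have /andP[c0 c1] := clip01_ge0_le1 (2 * g x).
by rewrite /bump_max le_max e0 ge_max e1.
Qed.

Lemma bump_max_lipschitz : lipschitz_in [set: X] (bump_max eta g).
Proof.
have [L' gL] := g_lip; exists (L + 2 * L') => x y _ _.
apply: (le_trans (max_dist _ _ _ _)); rewrite [leRHS]mulrDl; apply: lerD => //.
by rewrite (le_trans (clip01_double_dist _ _))// -mulrA ler_pM2l// gL.
Qed.

Lemma bump_max_eq1 (x : X) : (\forall y \near x, eta y = 1) ->
  \forall y \near x, bump_max eta g y = 1.
Proof.
apply: filterS => y y1; rewrite /bump_max y1; apply/max_idPl.
by have /andP[] := clip01_ge0_le1 (2 * g y).
Qed.

(** On [E] the bound 1 is enough; elsewhere in [V] one has [2 * g x > 1]; outside [V] the bump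
    vanishes. *)
Lemma bump_max_le x : bump_max eta g x <= \1_E x + 2 * `|g x|.
Proof.
have gx := ler_norm (g x); have gx0 := normr_ge0 (g x).
have /andP[_ b1] := bump_max_ge0_le1 x.
have E0 : 0 <= \1_E x :> R by rewrite indicE.
have [Vx|nVx] := pselect (V x).
  have [g1|g1] := leP (g x) 2^-1; last by rewrite (le_trans b1)//; lra.
  have -> : \1_E x = 1 :> R by rewrite indicE mem_set.
  by rewrite (le_trans b1)//; lra.
have /nbhs_singleton/= ex := etaV nVx; rewrite /bump_max ex.
by case: (clip01_cases (2 * g x)) => -[? ->]; rewrite ge_max; lra.
Qed.

(** Outside [V] the bump is 0 near [x] and only [clip01 (2 * g)] remains. In [V] with [g x > 1/2],
    the maximum is constantly 1 near [x]. Only on [E] does the slope of [eta] contribute. *)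
Lemma lip_bump_max x : (lip (bump_max eta g) x <= 2%:E * lip g x + (L * \1_E x)%:E)%E.
Proof.
have gfin : lip g x \is a fin_num.
  exact: LIP_loc_lip_fin_num (lipschitz_LIP_loc g_lip) I.
have E0 : 0 <= \1_E x :> R by rewrite indicE.
(* A second slope with weight 0 is inserted to match the shape of [lip_le]. *)
rewrite -[X in (X + _)%E]adde0 -[X in (_ + X + _)%E](mul0e (lip g x)).
apply: lip_le => //; first exact: mulr_ge0.
have [Vx|nVx] := pselect (V x); last first.
  have := etaV nVx; have /nbhs_singleton/= ex := etaV nVx.
  apply: filterS => y ey; rewrite /bump_max ex ey.
  have h0 z : Num.max 0 (clip01 (2 * g z)) = clip01 (2 * g z).
    by apply/max_idPr; have /andP[] := clip01_ge0_le1 (2 * g z).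
  by rewrite !h0 mul0r addr0 ler_wpDr ?clip01_double_dist// !mulr_ge0// mdist_ge0.
have [g1|g1] := leP (g x) 2^-1.
  rewrite indicE mem_set// mulr1; apply: nearW => y; rewrite mul0r addr0.
  by rewrite (le_trans (max_dist _ _ _ _))// addrC lerD ?clip01_double_dist.
have near_g : \forall y \near x, 2^-1 < g y.
  have gc := LIP_loc_continuous (lipschitz_LIP_loc g_lip) (I : [set: X] x).
  exact: (cvgr_gt _ gc).
have h1 z : 2^-1 < g z -> bump_max eta g z = 1.
  move=> gz; rewrite /bump_max; have /andP[_ ez] := eta01 z.
  by case: (clip01_cases (2 * g z)) => -[? ->]; try (apply/max_idPr); lra.
apply: filterS near_g => y /h1 ->; rewrite h1// subrr normr0.
by rewrite !addr_ge0// !mulr_ge0// mdist_ge0.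
Qed.

End bump_max.

Local Open Scope ereal_scope.

Lemma measurable_affine A (E : set X) (h : X -> \bar R) (c1 c2 c3 : R) :
  measurable (A : set (borel X)) -> measurable (E : set (borel X)) ->
  measurable_fun [set: borel X] (h : borel X -> \bar R) ->
  measurable_fun (A : set (borel X))
    ((fun x => (c1 * \1_E x)%:E + c2%:E + c3%:E * h x) : borel X -> \bar R).
Proof.
move=> mA mE mh.
have mhA : measurable_fun (A : set (borel X)) (h : borel X -> \bar R).
  exact: measurable_funS mh.
apply: emeasurable_funD; last exact: measurable_funeM.
apply: emeasurable_funD => //; apply/measurable_EFinP; exact: measurable_funM.
Qed.

(** The cutoff and its slope both have a majorant of this shape, with [h] a square; one estimate
    serves for both integrals. *)
Lemma integral_affine_le A (E : set X) (h : X -> \bar R) (c1 c2 c3 e1 e2 e3 : R) :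
  (0 <= c1)%R -> (0 <= c2)%R -> (0 <= c3)%R ->
  measurable (A : set (borel X)) -> measurable (E : set (borel X)) ->
  (forall x, 0 <= h x) -> measurable_fun [set: borel X] (h : borel X -> \bar R) ->
  m E <= e1%:E -> m A <= e2%:E -> \int[m]_x h x <= e3%:E ->
  \int[m]_(x in A) ((c1 * \1_E x)%:E + c2%:E + c3%:E * h x) <=
  (c1 * e1 + c2 * e2 + c3 * e3)%:E.
Proof.
move=> c10 c20 c30 mA mE h0 mh mEe mAe he.
have mhA : measurable_fun (A : set (borel X)) (h : borel X -> \bar R).
  exact: measurable_funS mh.
have mind : measurable_fun (A : set (borel X))
    ((fun x => (\1_E x)%:E) : borel X -> \bar R).
  by apply/measurable_EFinP; exact: measurable_indic.
have ind0 x : 0 <= (\1_E x)%:E :> \bar R by rewrite lee_fin indicE.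
have mc1 : measurable_fun (A : set (borel X))
    ((fun x => (c1 * \1_E x)%:E) : borel X -> \bar R).
  by under eq_fun do rewrite EFinM; exact: measurable_funeM.
have c1ind0 x : 0 <= (c1 * \1_E x)%:E by rewrite EFinM mule_ge0.
rewrite ge0_integralD//; first last.
- exact: measurable_funeM.
- by move=> x _; rewrite mule_ge0.
- exact: emeasurable_funD.
- by move=> x _; rewrite adde_ge0.
rewrite ge0_integralD// !EFinD !leeD//.
- under eq_integral do rewrite EFinM.
  rewrite ge0_integralZl// integral_indic// EFinM lee_wpmul2l//.
  by apply: (le_trans _ mEe); apply: le_measure; rewrite ?inE//; exact: measurableI.
- by rewrite (integral_cst m mA c2%:E) EFinM lee_wpmul2l.
- rewrite ge0_integralZl// EFinM lee_wpmul2l// (le_trans _ he)//.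
  exact: ge0_subset_integral.
Qed.

Lemma measurable_setI_sublevel A h (c : R) : measurable (A : set (borel X)) ->
  measurable_fun [set: borel X] (h : borel X -> R) ->
  measurable (A `&` [set x | (h x <= c)%R] : set (borel X)).
Proof.
move=> mA mh; apply: measurableI => //; rewrite -[X in measurable X]setTI.
have := mh measurableT _ (measurable_itv `]-oo, c]).
by rewrite preimage_itvNyc.
Qed.

(** Chebyshev: where [g >= 1] and [h <= 1/2], the square of [h - g] is at least 1/4. *)
Lemma measure_small_values A g h (theta : R) : measurable (A : set (borel X)) ->
  measurable_fun [set: borel X] (g : borel X -> R) ->
  measurable_fun [set: borel X] (h : borel X -> R) ->
  {ae m, forall x, A x -> (1 <= g x)%R} ->
  \int[m]_x ((h x - g x) ^+ 2)%:E <= theta%:E ->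
  m (A `&` [set x | (h x <= 2^-1)%R]) <= (4 * theta)%:E.
Proof.
move=> mA mg mh g1 hg.
have mE := measurable_setI_sublevel 2^-1 mA mh.
have msq : measurable_fun [set: borel X]
    ((fun x => ((h x - g x) ^+ 2)%:E) : borel X -> \bar R).
  by apply/measurable_EFinP/measurable_funX; exact: measurable_funB.
set E := _ `&` _ in mE *.
have msqE : measurable_fun (E : set (borel X))
    ((fun x => 4%:E * ((h x - g x) ^+ 2)%:E) : borel X -> \bar R).
  by apply: measurable_funeM; exact: measurable_funS msq.
rewrite -[leLHS]mul1e -(integral_cst m mE).
apply: (@le_trans _ _ (\int[m]_(x in E) (4%:E * ((h x - g x) ^+ 2)%:E))).
  apply: ae_ge0_le_integral => //.
  - by move=> x _; rewrite mule_ge0// lee_fin sqr_ge0.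
  - case: g1 => N [mN N0 gN]; exists N; split => // x /= nx; apply: gN => gx.
    apply: nx => -[Ax /= hx]; have := gx Ax => g1.
    rewrite -EFinM lee_fin; nra.
rewrite ge0_integralZl//; last 2 first.
- exact: measurable_funS msq.
- by move=> x _; rewrite lee_fin sqr_ge0.
rewrite EFinM lee_wpmul2l// (le_trans _ hg)//.
by apply: ge0_subset_integral => // x _; rewrite lee_fin sqr_ge0.
Qed.

Lemma integral_sqr_le g h (e : R) :
  measurable_fun [set: borel X] (g : borel X -> R) ->
  measurable_fun [set: borel X] (h : borel X -> R) ->
  \int[m]_x ((h x - g x) ^+ 2)%:E <= e%:E -> \int[m]_x (g x ^+ 2)%:E <= e%:E ->
  \int[m]_x (h x ^+ 2)%:E <= (4 * e)%:E.
Proof.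
move=> mg mh hg ge.
have mg2 : measurable_fun [set: borel X]
    ((fun x => (g x ^+ 2)%:E) : borel X -> \bar R).
  by apply/measurable_EFinP/measurable_funX.
have msq : measurable_fun [set: borel X]
    ((fun x => ((h x - g x) ^+ 2)%:E) : borel X -> \bar R).
  by apply/measurable_EFinP/measurable_funX; exact: measurable_funB.
have g20 x : 0 <= (g x ^+ 2)%:E by rewrite lee_fin sqr_ge0.
have hg20 x : 0 <= ((h x - g x) ^+ 2)%:E by rewrite lee_fin sqr_ge0.
apply: (@le_trans _ _ (\int[m]_x
    (2%:E * ((h x - g x) ^+ 2)%:E + 2%:E * (g x ^+ 2)%:E))).
  apply: ge0_le_integral => //.
  - by move=> x _; rewrite lee_fin sqr_ge0.
  - by apply/measurable_EFinP/measurable_funX.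
  - by apply: emeasurable_funD; exact: measurable_funeM.
  - move=> x _; rewrite -!EFinM -EFinD lee_fin.
    (* This square is exactly the difference of the two sides. *)
    have := sqr_ge0 (h x - 2 * g x)%R; nra.
rewrite ge0_integralD//; first last.
- exact: measurable_funeM.
- by move=> x _; rewrite mule_ge0.
- exact: measurable_funeM.
- by move=> x _; rewrite mule_ge0.
rewrite !ge0_integralZl//.
rewrite (_ : 4 * e = 2 * e + 2 * e)%R; last by ring.
by rewrite -[leRHS]/(2%:E * e%:E + 2%:E * e%:E) leeD// lee_wpmul2l.
Qed.

(* AM-GM in place of the Cauchy-Schwarz inequality. *)
Lemma le_add_sqr (s : R) (a : \bar R) : (0 < s)%R -> 0 <= a ->
  a <= s%:E + s^-1%:E * a ^+ 2.
Proof.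
move=> s0; case: a => [a||]// a0.
  rewrite -EFin_expe -EFinM -EFinD lee_fin; rewrite lee_fin in a0.
  have [as_|sa] := leP a s.
    by rewrite ler_wpDr// mulr_ge0 ?sqr_ge0// invr_ge0 ltW.
  rewrite ler_wpDl ?(ltW s0)// mulrC ler_pdivlMr//; nra.
by rewrite expe2 mulyy gt0_muley ?lte_fin ?invr_gt0.
Qed.

(** The order of the choices matters: [e] depends only on [tau] and [m A], whereas [theta] comes
    after the bump and absorbs its Lipschitz constant, however small [d] is. *)
Lemma capacity_cutoff A (tau : R) : open A -> m A < +oo -> (0 < tau)%R ->
  exists2 e : R, (0 < e)%R & forall K V (d : R) g, open V -> (0 < d)%R ->
    (forall x, K x -> ball x d `<=` V) ->
    L2 m g -> {ae m, forall x, V x -> (1 <= g x)%R} -> H12_norm2 m g < e%:E ->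
    exists phi, cutoff m A K tau phi.
Proof.
move=> oA Afin tau0; have mA := open_measurable_borel oA.
pose M := fine (m A).
have AM : m A = M%:E by rewrite fineK// ge0_fin_numE.
have M0 : (0 <= M)%R by rewrite fine_ge0.
(* Weight in AM-GM: the term [2 * s * M] is at most [tau / 8]. The cap at 1 yields [32 * e <= tau]
   below. *)
pose s := (Num.min 1 (tau / (16 * (M + 1))))%R.
have M1 : (0 < 16 * (M + 1))%R by rewrite mulr_gt0// ltr_wpDl.
have s0 : (0 < s)%R by rewrite lt_min ltr01 divr_gt0.
have s1 : (s <= 1)%R by rewrite ge_min lexx.
have sM : (16 * (s * M) <= tau)%R.
  have : (s * (16 * (M + 1)) <= tau)%R.
    by rewrite -ler_pdivlMr// ge_min lexx orbT.
  nra.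
(* Makes [2 * s^-1 * (4 * e)] equal to [tau / 4]. *)
pose e : R := (s * tau / 32)%R.
have e0 : (0 < e)%R by rewrite divr_gt0// mulr_gt0.
have es : (s^-1 * e = tau / 32)%R by rewrite /e !mulrA mulVf ?mul1r// gt_eqF.
have e_tau : (32 * e <= tau)%R by rewrite /e; nra.
exists e => // K V d g oV d0 KV gL2 g1 ge.
have [eta [[L L0 etaL] eta01 etaK etaV]] := exists_bump d0 KV.
(* Since [m E <= 4 * theta], the slope of the bump contributes at most
   [L * (4 * theta) <= tau / 2]. *)
pose theta := (Num.min e (tau / (8 * (L + 1))))%R.
have L1 : (0 < 8 * (L + 1))%R by rewrite mulr_gt0// ltr_wpDl.
have theta0 : (0 < theta)%R by rewrite lt_min e0 divr_gt0.
have theta_e : (theta <= e)%R by rewrite ge_min lexx.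
have Ltheta : (8 * (L * theta) <= tau)%R.
  have : (theta * (8 * (L + 1)) <= tau)%R.
    by rewrite -ler_pdivlMr// ge_min lexx orbT.
  nra.
have [ge2 /(_ theta theta0)[h [hlip hL2 hg lhe]]] := H12_norm2_lt gL2 ge.
have mg := L2_measurable gL2; have mh := L2_measurable hL2.
have mV := open_measurable_borel oV.
pose E := V `&` [set x | (h x <= 2^-1)%R].
have mE : measurable (E : set (borel X)) by exact: measurable_setI_sublevel.
have mEt : m E <= (4 * theta)%:E by exact: measure_small_values mV mg mh g1 hg.
have h2e : \int[m]_x (h x ^+ 2)%:E <= (4 * e)%:E.
  apply: integral_sqr_le mg mh _ (ltW ge2).
  by rewrite (le_trans hg)// lee_fin.
have phiA := LIP_locS (@subsetT _ A)
  (lipschitz_LIP_loc (bump_max_lipschitz etaL hlip)).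
have s20 : (0 <= 2 * s)%R by rewrite mulr_ge0// ltW.
have s21 : (0 <= 2 * s^-1)%R by rewrite mulr_ge0// invr_ge0 ltW.
have AM' : m A <= M%:E by rewrite AM.
exists (bump_max eta h); split.
- exact: bump_max_lipschitz etaL hlip.
- exact: bump_max_ge0_le1 h eta01.
- by move=> x Kx; apply: bump_max_eq1; exact: etaK.
- have mphi : measurable_fun (A : set (borel X))
      ((fun x => (bump_max eta h x)%:E) : borel X -> \bar R).
    by apply/measurable_EFinP; exact: LIP_loc_measurable oA phiA.
  have mh2 : measurable_fun [set: borel X]
    ((fun x => (h x ^+ 2)%:E) : borel X -> \bar R).
    by apply/measurable_EFinP/measurable_funX.
  have h20 x : 0 <= (h x ^+ 2)%:E by rewrite lee_fin sqr_ge0.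
  have R01 : (0 <= 1 :> R)%R by exact: ler01.
  have int_le := integral_affine_le R01 s20 s21 mA mE h20 mh2 mEt AM' h2e.
  apply: (@le_trans _ _ (1 * (4 * theta) + 2 * s * M + 2 * s^-1 * (4 * e))%:E); last first.
    by rewrite lee_fin; nra.
  apply: le_trans int_le; apply: ge0_le_integral => //.
  + by move=> x _; rewrite lee_fin; have /andP[] := bump_max_ge0_le1 h eta01 x.
  + exact: (measurable_affine 1%R (2 * s)%R (2 * s^-1)%R mA mE mh2).
  + move=> x _; rewrite mul1r.
    have := bump_max_le h eta01 etaV x; rewrite -/E => b1.
    have := @le_add_sqr s `|h x|%:E s0; rewrite lee_fin => /(_ (normr_ge0 _)).
    rewrite -EFin_expe -EFinM -!EFinD !lee_fin real_normK ?num_real// => h1.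
    apply: (le_trans b1); nra.
- have mphi := LIP_loc_lip_measurable oA phiA.
  have mlh := LIP_loc_lip_measurable openT (lipschitz_LIP_loc hlip).
  have mh2 : measurable_fun [set: borel X] ((fun x => lip h x ^+ 2) : borel X -> \bar R).
    by under eq_fun do rewrite expe2; exact: emeasurable_funM.
  have h20 x : 0 <= lip h x ^+ 2 by rewrite expe_ge0 ?lip_ge0.
  have int_le := integral_affine_le L0 s20 s21 mA mE h20 mh2 mEt AM' (ltW lhe).
  apply: (@le_trans _ _ (L * (4 * theta) + 2 * s * M + 2 * s^-1 * e)%:E); last first.
    by rewrite lee_fin; nra.
  apply: le_trans int_le; apply: ge0_le_integral => //.
  + by move=> x _; exact: lip_ge0.
  + exact: measurable_affine.
  + move=> x _; have := lip_bump_max L0 etaL eta01 etaV hlip x.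
    rewrite -/E => /le_trans; apply.
    rewrite addeC -addeA leeD2l// !EFinM -!muleA -ge0_muleDr//.
    * by rewrite lee_wpmul2l// le_add_sqr// lip_ge0.
    * by rewrite lee_fin ltW.
    * by rewrite mule_ge0// lee_fin invr_ge0 ltW.
Qed.

End capacity_cutoff.

(** * Absolute continuity *)

Section core.
Context (R : realType) (X : completeMetricType R).
Implicit Types (V : set X) (x : X).

(* Points at distance at least [1 / (n + 1)] from the complement of [V]. *)
Definition core V (n : nat) : set X := [set x | ball x (n.+1%:R^-1 : R) `<=` V].

Lemma open_coreC V n : open (~` core V n).
Proof.
rewrite openE => x /existsNP[y /not_implyP[]]; rewrite ballEmdist/= => xy nVy.
apply/near_mdist; exists (n.+1%:R^-1 - mdist x y); first by rewrite subr_gt0.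
move=> z xz zV; apply: nVy; apply: zV; rewrite ballEmdist/=.
by rewrite (le_lt_trans (metric_triangle z x y))// metric_sym -ltrBrDr.
Qed.

Lemma bigcup_core V : open V -> V `<=` \bigcup_n core V n.
Proof.
move=> oV x Vx; have /near_mdist[r r0 rV] : nbhs x V by exact: open_nbhs_nbhs.
have [n _ /(_ n (leqnn _)) nr] := near_infty_natSinv_lt (PosNum r0).
by exists n => // y; rewrite ballEmdist/= => xy; apply: rV; rewrite (lt_trans xy).
Qed.

Lemma nondecreasing_core V : nondecreasing_seq (core V).
Proof.
move=> a b ab; apply/subsetPset => x aV y bxy; apply: aV.
move: bxy; rewrite !ballEmdist/= => /lt_le_trans; apply.
by rewrite lef_pV2 ?posrE// ler_nat.
Qed.

Lemma measurable_setD_core V n : open V -> measurable (V `\` core V n : set (borel X)).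
Proof.
by move=> oV; apply: open_measurable_borel; apply: openI => //; exact: open_coreC.
Qed.

(** The cores exhaust the open set [V], and a finite measure is continuous from above. *)
Lemma cvg_measure_setD_core (mu : {finite_measure set (borel X) -> \bar R}) V :
  open V -> (mu (V `\` core V n) @[n --> \oo] --> 0)%E.
Proof.
move=> oV; rewrite -(measure0 mu).
have -> : set0 = \bigcap_n (V `\` core V n).
  apply/esym; rewrite -subset0 => x Vx; have [Vx0 _] := Vx 0 I.
  by have [n _ xn] := bigcup_core oV Vx0; have [_] := Vx n I.
apply: nonincreasing_cvg_mu.
- by rewrite ltey_eq fin_num_measure//; exact: measurable_setD_core.
- by move=> n; exact: measurable_setD_core.
- by apply: bigcapT_measurable => n; exact: measurable_setD_core.
- move=> a b ab; apply/subsetPset; apply: setDS.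
  by apply/subsetPset; exact: nondecreasing_core.
Qed.

End core.

(** * From sets with small cutoffs to sets of zero capacity *)

Section absolute_continuity.
Context (R : realType) (X : completeMetricType R).
Variable m : {measure set (borel X) -> \bar R}.
Local Open Scope ereal_scope.

(** Every real bound above the variation of [A \ K] also bounds that of [A]; finiteness of [Df] then
    allows subtraction. *)
Lemma totvar_measure_removable (f : X -> R)
    (Df : {finite_measure set (borel X) -> \bar R}) (A K : set X) :
  (exists2 D : set X, countable D & dense D) ->
  m.-integrable [set: borel X] (EFin \o f) ->
  is_total_variation_measure m f Df ->
  open A -> m A < +oo -> open (A `\` K) -> K `<=` A ->
  (forall tau : R, (0 < tau)%R -> exists phi, cutoff m A K tau phi) ->
  Df K = 0.
Proof.
move=> sepX intf DfE oA Afin oB KA cutK.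
have mA := open_measurable_borel oA; have mB := open_measurable_borel oB.
have KE : K = A `\` (A `\` K) by rewrite setDD (setIidr KA).
have Bfin : Df (A `\` K) \is a fin_num by exact: fin_num_measure.
have AB : Df A <= Df (A `\` K).
  apply/lee_addgt0Pr => e e0; rewrite (DfE A)//.
  rewrite -(fineK Bfin) -EFinD; apply: (totvar_le_setD sepX oA Afin oB KA intf cutK).
  by rewrite -(DfE _ oB) -(fineK Bfin) lte_fin ltrDl.
have AB0 : Df A - Df (A `\` K) <= 0.
  by rewrite -(fineK Bfin) leeBlDr// add0e fineK.
apply/eqP; rewrite eq_le measure_ge0 andbT [in leLHS]KE.
rewrite measureD//; last by rewrite ltey_eq fin_num_measure.
rewrite (setIidr (@subDsetl _ A K)); exact: AB0.
Qed.

Lemma Cap_eq0_neighborhoods (B : set X) (e : R) : Cap m B = 0 -> (0 < e)%R ->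
  exists V g, [/\ open V, B `<=` V, L2 m g,
    {ae m, forall x, V x -> (1 <= g x)%R} & H12_norm2 m g < e%:E].
Proof.
move=> B0 e0; have /ereal_inf_lt[_ [g [[gL2 _] [U /set_nbhsP[V [oV BV VU]] g1]] <-] ge] :
  Cap m B < e%:E by rewrite B0 lte_fin.
exists V, g; split => //.
case: g1 => N [mN N0 gN]; exists N; split => // x nx; apply: gN => gx.
by apply: nx => /VU.
Qed.

Lemma Cap_eq0_measure_setI_open (f : X -> R)
    (Df : {finite_measure set (borel X) -> \bar R}) (A B : set X) :
  (exists2 D : set X, countable D & dense D) ->
  m.-integrable [set: borel X] (EFin \o f) ->
  is_total_variation_measure m f Df ->
  open A -> m A < +oo -> measurable (B : set (borel X)) -> Cap m B = 0 ->
  Df (B `&` A) = 0.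
Proof.
move=> sepX intf DfE oA Afin mB B0; have mA := open_measurable_borel oA.
apply/eqP; rewrite eq_le measure_ge0 andbT; apply/lee_addgt0Pr => e e0.
have step (n : nat) : exists p : set X * (X -> R) * nat,
    [/\ open p.1.1, B `<=` p.1.1, L2 m p.1.2,
      {ae m, forall x, p.1.1 x -> (1 <= p.1.2 x)%R} &
      H12_norm2 m p.1.2 < n.+1%:R^-1%:E] /\
    Df (p.1.1 `\` core p.1.1 p.2) <= (e / (2 ^ n.+1)%:R)%:E.
  have n0 : (0 < n.+1%:R^-1 :> R)%R by [].
  have [V [g Vg]] := Cap_eq0_neighborhoods B0 n0.
  have [oV _ _ _ _] := Vg.
  (* The losses sum to at most [e] over all [n]. *)
  have en0 : (0 < e / (2 ^ n.+1)%:R)%R by rewrite divr_gt0// ltr0n expn_gt0.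
  have /ge0_cvge0P-/(_ (fun k => measure_ge0 Df _) _ en0)[i _ /(_ i (leqnn i)) /= iV] :=
    cvg_measure_setD_core Df oV.
  by exists (V, g, i).
have [p pP] := choice step.
pose V n := (p n).1.1; pose C n := core (V n) (p n).2.
have oV n : open (V n) by have [[]] := pP n.
have BV n : B `<=` V n by have [[]] := pP n.
have mVC n : measurable (V n `\` C n : set (borel X)) by exact: measurable_setD_core.
(* Cores are closed, so [A \ K] is open; and [K] keeps a positive distance from the complement of
   each [V n], which leaves room for a bump. *)
pose K := A `&` \bigcap_n C n.
have KA : K `<=` A by exact: subIsetl.
have AKE : A `\` K = A `&` \bigcup_n ~` C n.
  by rewrite /K setDE setCI setIUr setICr set0U setC_bigcap.
have oAK : open (A `\` K).
  by rewrite AKE; apply: openI => //; apply: bigcup_open => n _; exact: open_coreC.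
have mK : measurable (K : set (borel X)).
  rewrite -(setIidr KA) -setDD.
  by apply: measurableD => //; exact: open_measurable_borel.
have K0 : Df K = 0.
  apply: (totvar_measure_removable sepX intf DfE oA Afin oAK KA) => tau tau0.
  have [e' e'0 cut] := capacity_cutoff oA Afin tau0.
  (* For a given [tau], a single [V n] with test function of small enough norm suffices. *)
  have [n _ /(_ n (leqnn n)) /= ne'] := near_infty_natSinv_lt (PosNum e'0).
  have [[_ _ gL2 g1 gn] _] := pP n.
  apply: (cut K (V n) ((p n).2.+1%:R^-1)%R (p n).1.2) => //.
    by move=> x [_ /(_ n I)].
  by rewrite (lt_trans gn)// lte_fin.
have cover : B `&` A `<=` K `|` \bigcup_n (V n `\` C n).
  move=> x [Bx Ax]; have [Cx|/existsNP[n nCx]] := pselect (forall n, C n x).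
    by left; split => // n _.
  by right; exists n => //; split => //; exact: BV.
have mU : measurable (\bigcup_n (V n `\` C n) : set (borel X)).
  exact: bigcupT_measurable.
rewrite add0e; apply: (@le_trans _ _ (Df (K `|` \bigcup_n (V n `\` C n)))).
  by apply: le_measure; rewrite ?inE//; [exact: measurableI|exact: measurableU].
have {}K0 : Df K <= 0 by rewrite K0.
apply: (le_trans (measureU2 Df mK mU)); rewrite -[leRHS]add0e leeD//.
apply: (le_trans (measure_sigma_subadditive Df mVC mU (@subset_refl _ _))).
apply: (le_trans _ (epsilon_trick0 xpredT (ltW e0))).
by apply: lee_nneseries => // n _; have [_] := pP n.
Qed.

End absolute_continuity.

Theorem theorem2p5 (R : realType) (X : completeMetricType R)
    (m : {measure set (borel X) -> \bar R}) (f : X -> R)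
    (Df : {finite_measure set (borel X) -> \bar R}) :
  metric_measure_space m -> BV m f -> is_total_variation_measure m f Df ->
  forall B : set (borel X), measurable B -> Cap m B = 0%E -> Df B = 0%E.
Proof.
move=> [sepX [x0 _] ball_fin _] [intf _] DfE B mB B0.
(* Localisation to open sets of finite measure: balls of integer radius about a fixed point exhaust
   the space. *)
have BE : B = \bigcup_n (B `&` ball (x0 : X) (n%:R : R)).
  rewrite -setI_bigcupr; apply/esym/setIidl => x _.
  have [n _ /(_ n (leqnn n)) xn] := nbhs_infty_gtr (mdist (x0 : X) x).
  by exists n => //; rewrite ballEmdist.
apply/negligibleP => //; rewrite BE; apply: negligible_bigcup => n.
have oball := open_metric_ball (x0 : X) (n%:R : R).
apply/negligibleP.
  by apply: measurableI => //; exact: open_measurable_borel.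
exact: Cap_eq0_measure_setI_open sepX intf DfE oball (ball_fin _ _) mB B0.
Qed.
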